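(* Let $v\in L(X)$ be real valued with $v(x)\ge0$ for all $x\in X$ and $v(x)>0$ for some $x\in X$, and let $f\in L(X)$. The unique solution $u\in L(X)$ of $$\Delta u - v\cdot u = f \ \text{ on } X$$ is given on $X$ by $$u = - \widetilde G \tilde f, \quad \text{where}\quad \widetilde G = (I - \widetilde P)^{-1} = \sum_{n=0}^{\infty} \widetilde P^n,$$ with $\tilde f(x)=\dfrac{f(x)}{1+v(x)}$ and $\widetilde P=(\tilde p(x,y))_{x,y\in X}$, $\tilde p(x,y)=\dfrac{p(x,y)}{1+v(x)}$.
   Context: Let $(X,E)$ be a finite directed graph with $|X|\ge 2$, $E\subset X^2$ without loops, which is strongly connected. Each edge $(x,y)\in E$ carries a weight $a(x,y)>0$, and $a(x,y)=0$ if $(x,y)\notin E$. Put $m(x)=\sum_y a(x,y)$, $p(x,y)=a(x,y)/m(x)$, $P=(p(x,y))_{x,y\in X}$. $L(X)$ is the space of functions $X\to\mathbb{C}$ (column vectors), $Pu(x)=\sum_y p(x,y)u(y)$, and $\Delta=P-I$. *)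

(* Defs.v *)
From mathcomp Require Import all_boot all_order all_algebra.
From mathcomp Require Import complex.
From mathcomp Require Import all_classical all_reals all_analysis.
Import Order.TTheory GRing.Theory Num.Theory.
Import numFieldNormedType.Exports.

Set Implicit Arguments.
Unset Strict Implicit.
Unset Printing Implicit Defensive.

Local Open Scope ring_scope.
Local Open Scope complex_scope.

Definition strongly_connected (X : finType) (E : rel X) : Prop :=
  forall x y : X, connect E x y.

(* Mathcomp matrices are indexed by ordinals: a matrix with rows and columns
   in X is a matrix of size #|X|, through the bijections
   enum_val : 'I_#|X| -> X and enum_rank : X -> 'I_#|X|. *)
Definition kernel_mx (R : realType) (X : finType) (k : X -> X -> R) :
    'M[R]_#|X| :=
  \matrix_(i, j) k (enum_val i) (enum_val j).

(* All matrices here have real entries; they act on complex functions. *)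
Definition mxact (R : realType) (X : finType) (M : 'M[R]_#|X|)
    (u : X -> R[i]) : X -> R[i] :=
  fun x => \sum_(y : X) (M (enum_rank x) (enum_rank y))%:C * u y.

Section Network.
Variables (R : realType) (X : finType) (a : X -> X -> R).

Definition total_weight (x : X) : R := \sum_(y : X) a x y.

Definition trans_prob (x y : X) : R := a x y / total_weight x.

Definition trans_mx : 'M[R]_#|X| := kernel_mx trans_prob.

Definition laplacian_mx : 'M[R]_#|X| := trans_mx - 1%:M.

Variable v : X -> R.

Definition killed_prob (x y : X) : R := trans_prob x y / (1 + v x).

Definition killed_mx : 'M[R]_#|X| := kernel_mx killed_prob.

Definition killed_green : 'M[R]_#|X| := invmx (1%:M - killed_mx).

Definition killed_fun (f : X -> R[i]) : X -> R[i] :=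
  fun x => f x / (1 + v x)%:C.

Definition solves_poisson (f u : X -> R[i]) : Prop :=
  forall x : X, mxact laplacian_mx u x - (v x)%:C * u x = f x.

End Network.

(* Main.v *)
Require Import Defs.
From mathcomp Require Import all_boot all_order all_algebra.
From mathcomp Require Import complex.
From mathcomp Require Import all_classical all_reals all_analysis.
Set Implicit Arguments.
Unset Strict Implicit.
Unset Printing Implicit Defensive.

Import Order.TTheory GRing.Theory Num.Theory.
Import numFieldNormedType.Exports.
Local Open Scope classical_set_scope.
Local Open Scope ring_scope.
Local Open Scope complex_scope.

(** Write Q for the killed transition matrix.  The Poisson equation is
    equivalent to (I - Q) u = - f~, so the points to settle are that I - Q is
    invertible and that the Neumann series of Q converges to its inverse.  Both
    follow from a Lyapunov function: some h > 0 with Q h < h at every point.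

    To find h, let s_n = Q^n 1, the probability that the killed walk survives
    n steps.  The row sums of Q are at most 1, hence s_n decreases in n.  They
    are less than 1 where v > 0, and strong connectivity carries this to every
    starting point: if s_n(y) < 1 and Q(x,y) > 0, then s_(n+1)(x) < 1.  As X is
    finite, s_N < 1 everywhere for some N, and h = s_0 + ... + s_N satisfies
    h - Q h = 1 - s_(N+1) > 0 ([lyapunov_exists]).

    If a row vector w satisfies w = w Q, pairing |w| <= |w| Q with h gives
    sum_j |w_j| (h - Q h)_j <= 0, so w = 0 and I - Q is invertible
    ([subr1_lyapunov_unitmx]).  Moreover Q h <= c h for some c < 1, since there
    are finitely many points; then Q^k h <= c^k h, so the entries of Q^k
    decrease geometrically, and the partial sums of the series, which equal
    (I - Q^k) (I - Q)^-1, tend to (I - Q)^-1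
    ([neumann_series_lyapunov]). *)

(** * Survival probabilities and a Lyapunov function *)

Section Survival.
Context {R : realType} {X : finType}.
Variable q : X -> X -> R.
Hypothesis q_ge0 : forall x y, 0 <= q x y.
Hypothesis q_substoch : forall x, \sum_y q x y <= 1.

Fixpoint survival (n : nat) (x : X) : R :=
  if n is n'.+1 then \sum_y q x y * survival n' y else 1.

Lemma survivalS_le n x : survival n.+1 x <= survival n x.
Proof.
elim: n x => [|n IH] x /=.
  by under eq_bigr do rewrite mulr1; exact: q_substoch.
by apply: ler_sum => y _; apply: ler_wpM2l => //; exact: IH.
Qed.

Lemma survival_anti m n x : (m <= n)%N -> survival n x <= survival m x.
Proof.
move=> /subnK <-; elim: (n - m)%N => [|k IH]; first by rewrite add0n.
by rewrite addSn (le_trans (survivalS_le _ _)).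
Qed.

Lemma survivalS_lt1 n x y : 0 < q x y -> survival n y < 1 ->
  survival n.+1 x < 1.
Proof.
move=> qxy sy; apply: lt_le_trans (q_substoch x) => /=.
rewrite (bigD1 y)//= [ltRHS](bigD1 y)//=; apply: ltr_leD.
  by rewrite gtr_pMr.
by apply: ler_sum => z _; rewrite ler_piMr // (survival_anti _ (leq0n n)).
Qed.

Lemma survival_lt1_connect (e : rel X) x z :
  (forall x y, e x y -> 0 < q x y) -> \sum_y q z y < 1 -> connect e x z ->
  exists n, survival n x < 1.
Proof.
move=> e_q qz /connectP[p]; elim: p x => [|y p IH] x /=.
  by move=> _ <-; exists 1%N => /=; under eq_bigr do rewrite mulr1.
case/andP=> exy ep zE; have [n sy] := IH y ep zE.
by exists n.+1; apply: survivalS_lt1 sy; exact: e_q.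
Qed.

(** The Lyapunov function is the Green function of the walk, truncated at a
    time N by which survival is uncertain from every starting point; the
    defect h - Q h telescopes to 1 - survival N.+1. *)
Lemma lyapunov_exists : (forall x, exists n, survival n x < 1) ->
  exists h : X -> R, (forall x, 0 < h x) /\
                     (forall x, \sum_y q x y * h y < h x).
Proof.
move=> /choice[n s_lt1]; pose N := (\max_x n x)%N.
have sN x : survival N.+1 x < 1.
  apply: le_lt_trans (s_lt1 x); apply: survival_anti.
  by apply/leqW/leq_bigmax.
have s_ge0 k x : 0 <= survival k x.
  elim: k x => [|k IH] x /=; first exact: ler01.
  by apply: sumr_ge0 => y _; rewrite mulr_ge0.
exists (fun x => \sum_(k < N.+1) survival k x); split=> x.
  by rewrite big_ord_recl ltr_pwDl ?ltr01 ?sumr_ge0.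
under eq_bigr do rewrite mulr_sumr.
rewrite exchange_big /= [ltLHS](_ : _ = \sum_(k < N.+1) survival k.+1 x) //.
rewrite [ltLHS]big_ord_recr [ltRHS]big_ord_recl /= addrC ltrD2r.
exact: sN.
Qed.

End Survival.

(** * The Neumann series of a nonnegative matrix *)

Lemma cvg_mx_entrywise (T : topologicalType) (m n : nat)
    (u : nat -> 'M[T]_(m, n)) (M : 'M[T]_(m, n)) :
  (forall i j, (fun k => u k i j) @ \oo --> M i j) -> u @ \oo --> M.
Proof.
move=> uM A [P PM PA].
suff : \forall k \near \oo, forall i j, P i j (u k i j).
  by apply: filterS => k uP; apply: PA => i j; exact: uP.
by do 2!apply: filter_forall => ?; exact: uM.
Qed.

Lemma mx_telescope (R : pzRingType) (n : nat) (Q : 'M[R]_n) (k : nat) :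
  series (fun k => Q ^+ k) k *m (1%:M - Q) = 1%:M - Q ^+ k.
Proof.
rewrite /series /=; elim: k => [|k IH].
  by rewrite big_geq // mul0mx expr0 subrr.
rewrite big_nat_recr //= mulmxDl IH mulmxBr mulmx1 exprSr -mulmxE.
by rewrite addrA subrK.
Qed.

Section Lyapunov.
Context {R : realType} {n : nat}.
Variables (Q : 'M[R]_n) (h : 'I_n -> R).
Hypothesis Q_ge0 : forall i j, 0 <= Q i j.
Hypothesis h_gt0 : forall i, 0 < h i.
Hypothesis Qh_lt : forall i, \sum_j Q i j * h j < h i.

Lemma subr1_lyapunov_unitmx : 1%:M - Q \in unitmx.
Proof.
rewrite -row_free_unit; apply: inj_row_free => w.
rewrite mulmxBr mulmx1 => /eqP; rewrite subr_eq0 => /eqP wQ.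
pose d i : R := `|w 0 i| * (h i - \sum_j Q i j * h j).
have d_ge0 i : 0 <= d i by rewrite mulr_ge0 // subr_ge0 ltW.
have sum_d_le0 : \sum_i d i <= 0.
  rewrite /d; under eq_bigr do rewrite mulrBr.
  rewrite sumrB subr_le0; under [leRHS]eq_bigr do rewrite mulr_sumr.
  rewrite exchange_big /=; apply: ler_sum => j _.
  under eq_bigr do rewrite mulrA.
  rewrite -mulr_suml ler_wpM2r ?(ltW (h_gt0 j)) // {1}wQ mxE.
  apply: le_trans (ler_norm_sum _ _ _) _; apply: ler_sum => i _.
  by rewrite normrM (ger0_norm (Q_ge0 i j)).
have sum_d0 : \sum_i d i = 0.
  by apply/eqP; rewrite eq_le sum_d_le0 sumr_ge0.
apply/rowP => i; rewrite mxE; apply/eqP; rewrite -normr_eq0.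
have /(_ i isT)/eqP := psumr_eq0P (fun i _ => d_ge0 i) sum_d0.
by rewrite mulf_eq0 => /orP[//|]; rewrite gt_eqF // subr_gt0.
Qed.

Lemma lyapunov_rate :
  exists c, [/\ 0 <= c, c < 1 & forall i, \sum_j Q i j * h j <= c * h i].
Proof.
exists (\big[Num.max/0]_i ((\sum_j Q i j * h j) / h i)); split.
- exact: bigmax_ge_id.
- by apply/bigmax_ltP; split=> // i _; rewrite ltr_pdivrMr ?mul1r.
- by move=> i; rewrite -ler_pdivrMr //; exact: le_bigmax.
Qed.

Lemma expr_lyapunov_cvg0 i j : (fun k => (Q ^+ k) i j) @ \oo --> (0 : R).
Proof.
have [c [c_ge0 c_lt1 Qh]] := lyapunov_rate.
have Qk_ge0 k i' j' : 0 <= (Q ^+ k) i' j'.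
  elim: k i' j' => [|k IH] i' j'; first by rewrite expr0 mxE ler0n.
  by rewrite exprS mxE sumr_ge0 // => l _; rewrite mulr_ge0.
have Qkh k i' : \sum_j' (Q ^+ k) i' j' * h j' <= c ^+ k * h i'.
  elim: k i' => [|k IH] i'.
    rewrite !expr0 mul1r (bigD1 i') //= big1 ?mxE ?eqxx ?mul1r ?addr0 //.
    by move=> l; rewrite mxE eq_sym => /negPf->; rewrite mul0r.
  rewrite exprSr; under eq_bigr do rewrite mxE mulr_suml.
  rewrite exchange_big /=.
  apply: (@le_trans _ _ (\sum_l (Q ^+ k) i' l * (c * h l))).
    apply: ler_sum => l _; under eq_bigr do rewrite -mulrA.
    by rewrite -mulr_sumr ler_wpM2l.
  under eq_bigr do rewrite mulrCA.
  by rewrite -mulr_sumr exprS -mulrA ler_wpM2l.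
have Qkij k : (Q ^+ k) i j <= c ^+ k * (h i / h j).
  rewrite mulrA ler_pdivlMr //; apply: le_trans (Qkh k i).
  rewrite [leRHS](bigD1 j) //= lerDl sumr_ge0 // => l _.
  by rewrite mulr_ge0 // ltW.
apply: (@squeeze_cvgr _ _ _ _ (fun=> 0) (fun k => c ^+ k * (h i / h j))).
- by apply: nearW => k; rewrite Qk_ge0 Qkij.
- exact: cvg_cst.
- rewrite -[X in _ --> X](mul0r (h i / h j)); apply: cvgMr_tmp.
  by apply: cvg_expr; rewrite ger0_norm.
Qed.

Lemma neumann_series_lyapunov :
  series (fun k => Q ^+ k) @ \oo --> invmx (1%:M - Q).
Proof.
set G := invmx _.
have seriesE k : series (fun k => Q ^+ k) k = G - Q ^+ k *m G.
  rewrite -[G in G - _]mul1mx -mulmxBl -mx_telescope mulmxK //.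
  exact: subr1_lyapunov_unitmx.
apply: cvg_mx_entrywise => i j.
rewrite [X in X @ _ --> _](_ : _ =
  fun k => G i j - \sum_l (Q ^+ k) i l * G l j); last first.
  by apply/funext => k; rewrite seriesE !mxE.
rewrite -[X in _ --> X]subr0; apply: cvgB; first exact: cvg_cst.
rewrite -[X in _ --> X](@big1 R 0 +%R _ (index_enum 'I_n) xpredT
  (fun l => 0 * G l j)); last by move=> l _; rewrite mul0r.
apply: cvg_big => [|l _]; first exact: add_continuous.
by apply: cvgMr_tmp; exact: expr_lyapunov_cvg0.
Qed.

End Lyapunov.

(** * The Poisson equation as a linear system *)

Section Action.
Context {R : realType} {X : finType}.
Implicit Types (M N : 'M[R]_#|X|) (u w : X -> R[i]) (x : X).

Lemma mxact1 u x : mxact 1%:M u x = u x.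
Proof.
rewrite /mxact (bigD1 x) //= big1 ?mxE ?eqxx ?mul1r ?addr0 // => y yx.
by rewrite mxE (inj_eq enum_rank_inj) eq_sym (negPf yx) mul0r.
Qed.

Lemma mxact_mulmx M N u x : mxact (M *m N) u x = mxact M (mxact N u) x.
Proof.
rewrite /mxact; under [RHS]eq_bigr do rewrite mulr_sumr.
rewrite exchange_big /=; apply: eq_bigr => z _.
rewrite mxE rmorph_sum mulr_suml.
rewrite (reindex enum_rank) /=; last exact: onW_bij _ (enum_rank_bij X).
by apply: eq_bigr => y _; rewrite rmorphM mulrA.
Qed.

Lemma mxactBl M N u x : mxact (M - N) u x = mxact M u x - mxact N u x.
Proof.
rewrite /mxact -sumrB; apply: eq_bigr => y _.
by rewrite !mxE rmorphB mulrBl.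
Qed.

Lemma mxactN M u x : mxact M (fun y => - u y) x = - mxact M u x.
Proof. by rewrite /mxact -sumrN; apply: eq_bigr => y _; rewrite mulrN. Qed.

Lemma eq_mxact M u w x : u =1 w -> mxact M u x = mxact M w x.
Proof. by move=> uw; apply: eq_bigr => y _; rewrite uw. Qed.

Lemma mxact_kernel (k : X -> X -> R) u x :
  mxact (kernel_mx k) u x = \sum_y (k x y)%:C * u y.
Proof. by apply: eq_bigr => y _; rewrite mxE !enum_rankK. Qed.

(** Division of the equation at x by 1 + v x. *)
Lemma solves_poissonE (a : X -> X -> R) (v : X -> R) (f u : X -> R[i]) :
  (forall x, 0 <= v x) ->
  solves_poisson a v f u <->
  forall x, mxact (1%:M - killed_mx a v) u x = - killed_fun v f x.
Proof.
move=> v_ge0.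
have v1 x : 1 + v x != 0 by rewrite gt_eqF // ltr_wpDr.
have v1C x : (1 + v x)%:C != 0 :> R[i].
  by rewrite -(rmorph0 (real_complex R)) (inj_eq (@complexI R)).
have actE x : mxact (laplacian_mx a) u x - (v x)%:C * u x =
              - ((1 + v x)%:C * mxact (1%:M - killed_mx a v) u x).
  rewrite /laplacian_mx !mxactBl mxact1 mulrBr opprB /trans_mx /killed_mx.
  rewrite !mxact_kernel mulr_sumr -addrA; congr (_ + _).
    apply: eq_bigr => y _; rewrite mulrA -rmorphM /killed_prob.
    by rewrite [(1 + v x) * _]mulrC divfK.
  by rewrite rmorphD rmorph1 mulrDl mul1r opprD.
split=> eq_u x.
  by rewrite /killed_fun -(eq_u x) actE mulNr opprK mulrAC mulfV ?mul1r.
by rewrite actE eq_u /killed_fun mulrN opprK mulrCA mulfV ?mulr1.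
Qed.

End Action.

(** * The killed walk *)

Section KilledWalk.
Context {R : realType} {X : finType}.
Variables (a : X -> X -> R) (v : X -> R).
Hypothesis a_ge0 : forall x y, 0 <= a x y.
Hypothesis v_ge0 : forall x, 0 <= v x.

Let v1_gt0 x : 0 < 1 + v x. Proof. by rewrite ltr_wpDr. Qed.

Lemma killed_prob_ge0 x y : 0 <= killed_prob a v x y.
Proof. by rewrite !divr_ge0 ?sumr_ge0 // ltW. Qed.

Lemma killed_prob_gt0 x y : 0 < a x y -> 0 < killed_prob a v x y.
Proof.
move=> axy; rewrite !divr_gt0 // /total_weight (bigD1 y) //=.
by rewrite ltr_wpDr // sumr_ge0.
Qed.

(** At a vertex of total weight 0, every trans_prob is 0 by the convention on
    division, whence only an inequality. *)
Lemma sum_killed_prob_le x : \sum_y killed_prob a v x y <= (1 + v x)^-1.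
Proof.
rewrite -!mulr_suml ler_piMl ?invr_ge0 ?(ltW (v1_gt0 x)) //.
rewrite -/(total_weight a x).
have [->|m0] := eqVneq (total_weight a x) 0; first by rewrite mul0r.
by rewrite divff.
Qed.

Lemma sum_killed_prob_le1 x : \sum_y killed_prob a v x y <= 1.
Proof.
apply: le_trans (sum_killed_prob_le x) _.
by rewrite invf_le1 // lerDl.
Qed.

Lemma sum_killed_prob_lt1 x : 0 < v x -> \sum_y killed_prob a v x y < 1.
Proof.
move=> vx; apply: le_lt_trans (sum_killed_prob_le x) _.
by rewrite invf_lt1 // ltrDl.
Qed.

End KilledWalk.

Theorem mainTheorem12 (R : realType) (X : finType) (E : rel X)
    (a : X -> X -> R) (v : X -> R) (f : X -> R[i])
    (cardX : (2 <= #|X|)%N)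
    (E_loopless : irreflexive E)
    (E_connected : strongly_connected E)
    (a_edge : forall x y : X, E x y -> 0 < a x y)
    (a_nonedge : forall x y : X, ~~ E x y -> a x y = 0)
    (v_ge0 : forall x : X, 0 <= v x)
    (v_neq0 : exists x : X, 0 < v x) :
  [/\ 1%:M - killed_mx a v \in unitmx,
      series (fun n : nat => killed_mx a v ^+ n) @ \oo --> killed_green a v,
      solves_poisson a v f
        (fun x : X => - mxact (killed_green a v) (killed_fun v f) x) &
      forall u : X -> R[i], solves_poisson a v f u ->
        forall x : X, u x = - mxact (killed_green a v) (killed_fun v f) x].
Proof.
have a_ge0 x y : 0 <= a x y.
  by have [/a_edge/ltW//|/a_nonedge->] := boolP (E x y).
have q_ge0 := killed_prob_ge0 a_ge0 v_ge0.
have [z vz] := v_neq0.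
have [h [h_gt0 qh]] : exists h : X -> R, (forall x, 0 < h x) /\
    forall x, \sum_y killed_prob a v x y * h y < h x.
  apply: lyapunov_exists => // [x|x]; first exact: sum_killed_prob_le1.
  apply: (@survival_lt1_connect _ _ _ _ _ E x z) => //.
  - exact: sum_killed_prob_le1.
  - by move=> x' y /a_edge; exact: killed_prob_gt0.
  - exact: sum_killed_prob_lt1.
have Q_ge0 i j : 0 <= killed_mx a v i j by rewrite mxE.
pose hI (i : 'I_#|X|) := h (enum_val i).
have hI_gt0 i : 0 < hI i by exact: h_gt0.
have QhI i : \sum_j killed_mx a v i j * hI j < hI i.
  rewrite (reindex enum_rank) /=; last exact: onW_bij _ (enum_rank_bij X).
  by under eq_bigr do rewrite mxE /hI enum_rankK; exact: qh.
have unitQ := subr1_lyapunov_unitmx Q_ge0 hI_gt0 QhI.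
split=> //; first exact: neumann_series_lyapunov Q_ge0 hI_gt0 QhI.
- apply/solves_poissonE => // x.
  by rewrite mxactN -mxact_mulmx mulmxV // mxact1.
- move=> u /(solves_poissonE _ _ _ v_ge0) u_sol x.
  rewrite -[LHS]mxact1 -(mulVmx unitQ) mxact_mulmx.
  by rewrite (eq_mxact _ _ u_sol) mxactN.
Qed.
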